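(* $\limsup_{d\to\infty} p_d \le 1/6$, where $p_d$ is the critical drift of the frog model with drift on the rooted $d$-ary tree.
   Context: For an integer $d\ge 2$ let $\mathbb T_d$ be the infinite rooted $d$-ary tree (each vertex has $d$ children) with root $\varnothing$. For $p\in(0,1)$ the frog model with drift $\mathrm{FM}(d,p)$ on $\mathbb T_d$ is as follows. Initially there is one active particle at $\varnothing$ and one dormant particle at each non-root vertex. In discrete time, every active particle independently performs a $p$-biased nearest neighbor random walk: at each time step, from a non-root vertex it moves one step towards the root (to the parent) with probability $p$, and with probability $1-p$ it moves away from the root to a uniformly sampled child vertex; from the root it moves to a uniformly sampled child. When an active particle moves to a site containing a dormant particle, the dormant particle becomes active and begins its own independent $p$-biased random walk. A root visit is counted each time an active particle moves to the root; $V_{\mathrm{FM}(d,p)}\in\{0,1,\dots\}\cup\{\infty\}$ is the total number of root visits over all time. $\mathrm{FM}(d,p)$ is recurrent if $\mathbf P(V_{\mathrm{FM}(d,p)}=\infty)=1$. Define $p_d=\inf\{p\in(0,1):\mathrm{FM}(d,p)\text{ is recurrent}\}$. *)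

(* Defs.v *)
From mathcomp Require Import all_boot all_order all_algebra.
From mathcomp Require Import all_classical all_reals all_analysis.

Set Implicit Arguments.
Unset Strict Implicit.
Unset Printing Implicit Defensive.
Import Order.TTheory GRing.Theory Num.Theory.

Local Open Scope classical_set_scope.
Local Open Scope ring_scope.

(* A vertex of the rooted d-ary tree is the word leading to it from the root,
   last letter first: [::] is the root, the children of v are the words i :: v
   with i : 'I_d, and the parent of i :: v is v. *)
Notation vertex d := (seq 'I_d).

Definition tree_root (d : nat) : vertex d := [::].

(* v is a child of u *)
Definition is_child (d : nat) (v u : vertex d) : bool :=
  if v is _ :: v' then v' == u else false.

Definition step_prob (R : realType) (d : nat) (p : R) (u v : vertex d) : R :=
  if u == tree_root d then (is_child v u)%:R / d%:R
  else p * (is_child u v)%:R + (1 - p) * ((is_child v u)%:R / d%:R).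

Section Walks.
Context {R : realType} {disp : measure_display} {T : measurableType disp}.

Definition is_biased_walk (P : probability T R) (d : nat) (p : R)
    (v : vertex d) (X : nat -> T -> vertex d) : Prop :=
  [/\ forall n x, measurable [set w | X n w = x],
      forall w, X 0%N w = v &
      forall (n : nat) (x : nat -> vertex d),
        P [set w | forall k, (k <= n.+1)%N -> X k w = x k] =
        (P [set w | forall k, (k <= n)%N -> X k w = x k] *
         (step_prob p (x n) (x n.+1))%:E)%E].

Definition walk_sigma_algebra (d : nat) (X : nat -> T -> vertex d) :
    set (set T) :=
  <<s [set A | exists n x, A = [set w | X n w = x]] >>.

Definition independent_walks (P : probability T R) (d : nat)
    (S : vertex d -> nat -> T -> vertex d) : Prop :=
  forall (F : seq (vertex d)) (A : vertex d -> set T),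
    uniq F ->
    (forall v, v \in F -> walk_sigma_algebra (S v) (A v)) ->
    P (\bigcap_(v in [set` F]) A v) = (\prod_(v <- F) P (A v))%E.

(* S v n w is the location, after n of its own steps, of the particle that
   starts (dormant unless v is the root) at v. *)
Definition frog_walks (P : probability T R) (d : nat) (p : R)
    (S : vertex d -> nat -> T -> vertex d) : Prop :=
  (forall v, is_biased_walk P p v (S v)) /\ independent_walks P S.

End Walks.

Section Dynamics.
Context {d : nat} (s : vertex d -> nat -> vertex d).

(* Number of steps that the particle of v has made by time t, and None as long
   as it is dormant: a particle woken at time t makes its first step at time
   t.+1. *)
Fixpoint steps_made (t : nat) (v : vertex d) : option nat :=
  match t with
  | 0 => if v == tree_root d then Some 0%N else None
  | t'.+1 =>
      if steps_made t' v is Some k then Some k.+1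
      else if `[< exists u k, steps_made t' u = Some k /\ s u k.+1 = v >]
           then Some 0%N else None
  end.

(* Pairs (t, v) such that the particle of v is active at time t and its next
   step, ending at time t.+1, brings it to the root. *)
Definition root_moves : set (nat * vertex d) :=
  [set tv | exists k,
     steps_made tv.1 tv.2 = Some k /\ s tv.2 k.+1 = tree_root d].

Definition root_visits (R : realType) : \bar R := counting root_moves.

End Dynamics.

(* The joint law of the walks, hence that of the number of root visits, is
   determined by d and p, and is realized on some probability space by the
   Kolmogorov extension theorem when d > 0 and 0 < p < 1; the quantifier over
   realizations only avoids the choice of a particular one. *)
Definition recurrent (R : realType) (d : nat) (p : R) : Prop :=
  forall (disp : measure_display) (T : measurableType disp)
         (P : probability T R) (S : vertex d -> nat -> T -> vertex d),
    frog_walks P p S ->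
    P [set w | root_visits (fun v n => S v n w) R = +oo%E] = 1%E.

(* The infimum is taken in the extended reals, so that it is +oo, rather than
   a spurious real number, if no p is recurrent. *)
Definition critical_drift (R : realType) (d : nat) : \bar R :=
  ereal_inf [set p%:E | p in [set p : R | 0 < p < 1 /\ recurrent d p]].

(* Main.v *)
Require Import Defs.
From mathcomp Require Import all_boot all_order all_algebra.
From mathcomp Require Import all_classical all_reals all_analysis.
From mathcomp Require Import finmap zify ring lra.
Set Implicit Arguments.
Unset Strict Implicit.
Unset Printing Implicit Defensive.
Import Order.TTheory GRing.Theory Num.Theory.
Import numFieldNormedType.Exports.
Local Open Scope classical_set_scope.
Local Open Scope ring_scope.

(** The bound holds because p = 1/6 itself is recurrent as soon as d is large.
    When d is infinite, a downward step always wakes a new frog, so that the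
    distances to the root perform a branching random walk: a particle at
    height l is replaced by one particle at l - 1 with probability p and by two
    at l + 1 with probability 1 - p.  The mean of y ^ height over the offspring
    is minimal at 2 sqrt (2 p (1 - p)), which exceeds 1 when 8 p (1 - p) > 1,
    and then the branching walk visits every height infinitely often with
    positive probability.  At p = 1/6 one has 8 p (1 - p) = 10/9.

    Since the vertices that are ever woken are those reachable from the root
    along the walks, the order in which awake frogs move is irrelevant for the
    number of root visits.  One may therefore reveal the walks step by step,
    choosing at each time which awake frog moves; the conditional law of the
    next position is given by step_prob (visits_bound_step).  Bounds on the
    probability that fewer than M moves to the root occur then obey the rules
    of a one-player game (failure_rules), and it remains to play this game.

    When a vertex v is entered for the first time there are two frogs at v.
    The player moves the frogs at v one after the other; whenever one of them
    enters a new child, the same strategy is played below that child and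
    brings some frogs back to v; frogs that enter a child for the second time
    are abandoned.  At most m children are used, which costs at most m / d per
    step.  The law of the number of frogs that leave v upwards after n levels
    of recursion is returns p d m n.  Its generating function G_n satisfies
    G_(n+1)(x) <= h ^ 2 + G_n(1 - p + p x) ^ m whenever
    p x + (1 - p) (m / d + G_n(h)) <= h (pgf_returnsS).

    Near 1 the inequality says that an upper bound 1 - a t for G_n(1 - t) can be
    replaced by one with the slope 2 p / (1 - (1 - p) a) instead of a; this
    map has no fixed point when 8 p (1 - p) > 1, so after finitely many
    iterations the slope passes 1 / (1 - p).  From then on h = 1 - t may be
    used for all x <= 1, and G_n(1 - s) stays below a constant Y < 1 while s is
    halved at each further level (returns_large).  Hence, for every K, at
    least K frogs return with probability nearly 1 - Y.

    From any state, some frog reaches an unseen vertex; below it the strategy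
    produces with probability bounded below so many frogs that M of them go
    straight up to the root, however deep the vertex is.  If this fails, one
    starts again, so the probability of failure is at most
    ((1 + Y) / 2) ^ k for every k (fail_shrink). *)

(** * Exploring the subtree of a vertex *)

Section Exploration.
Context {R : realType}.
Implicit Types (T : (nat -> R) -> R) (b : nat -> R) (p x h t s a : R).

(** Laws on nat are handled through their expectation operators: the strategy
    below has a law given by nested finite recursions, and all that matters is
    how it integrates functions. *)
Definition expectation T :=
  [/\ forall b b', (forall k, b k <= b' k) -> T b <= T b',
      forall a a' b b',
        T (fun k => a * b k + a' * b' k) = a * T b + a' * T b' &
      T (fun=> 1) = 1].

Definition pgf T x := T (fun k => x ^+ k).

(** The expectation of b at the final number of frogs sent to the parent of v,
    when q frogs wait at v, e have already gone up, u children of v have been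
    entered, j more may be entered, and a new child gives back a number of
    frogs with law T.  A frog that steps down into a child entered before, or
    into any child once j = 0, is abandoned. *)
Fixpoint explore p (d : nat) T b (j u : nat) {struct j} : nat -> nat -> R :=
  fix go q e := if q is q'.+1 then
    p * go q' e.+1 + (1 - p) *
    (if j is j'.+1 then
       (u%:R / d%:R) * go q' e +
       (1 - u%:R / d%:R) * T (fun k => explore p d T b j' u.+1 (k + q')%N e)
     else go q' e)
  else b e.

(** The exploration of v starts with the frog that has just entered v and the
    one it has woken, hence with q = 2. *)
Fixpoint returns p (d m n : nat) b : R :=
  if n is n'.+1 then explore p d (returns p d m n') b m 0 2 0 else b 0%N.

Arguments explore : simpl never.

Lemma explore0 p d T b j u e : explore p d T b j u 0 e = b e.
Proof. by case: j. Qed.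

Lemma explore_exhausted p d T b u q e :
  explore p d T b 0 u q.+1 e =
  p * explore p d T b 0 u q e.+1 + (1 - p) * explore p d T b 0 u q e.
Proof. by []. Qed.

Lemma exploreS p d T b j u q e :
  explore p d T b j.+1 u q.+1 e =
  p * explore p d T b j.+1 u q e.+1 + (1 - p) *
  (u%:R / d%:R * explore p d T b j.+1 u q e +
   (1 - u%:R / d%:R) * T (fun k => explore p d T b j u.+1 (k + q)%N e)).
Proof. by []. Qed.

Definition exploreE := (explore0, explore_exhausted, exploreS).

Lemma expectation_scale T a b : expectation T ->
  T (fun k => a * b k) = a * T b.
Proof.
move=> [_ lin _]; rewrite -[RHS]addr0 -(mul0r (T b)) -lin.
by congr T; apply/funext => k; rewrite mul0r addr0.
Qed.

Lemma expectation_le T b b' : expectation T ->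
  (forall k, b k <= b' k) -> T b <= T b'.
Proof. by case=> + _ _; exact. Qed.

Lemma expectation_const T a : expectation T -> T (fun=> a) = a.
Proof.
move=> ET; rewrite -[in RHS](mulr1 a); case: (ET) => _ _ <-.
by rewrite -expectation_scale//; congr T; apply/funext => k; rewrite mulr1.
Qed.

Lemma fraction_itv (d u : nat) : (u <= d)%N -> 0 <= (u%:R / d%:R : R) <= 1.
Proof.
move=> ud; rewrite divr_ge0//=; case: d ud => [|d] ud.
  by rewrite invr0 mulr0.
by rewrite ler_pdivrMr ?ltr0n// mul1r ler_nat.
Qed.

Lemma explore_expectation p d T j u q e : 0 <= p <= 1 -> (u + j <= d)%N ->
  expectation T -> expectation (fun b => explore p d T b j u q e).
Proof.
move=> /andP[p0 p1] + [le lin one].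
elim: j u q e => [|j IHj] u q e ujd.
  split; elim: q e => [|q IHq] e; try by move=> *; rewrite !explore0.
  - move=> b b' bb'; rewrite !exploreE lerD// ler_wpM2l ?subr_ge0//; exact: IHq.
  - by move=> a a' b b'; rewrite !exploreE !IHq; ring.
  - by rewrite !exploreE !IHq; ring.
have /andP[f0 f1] := @fraction_itv d u (leq_trans (leq_addr _ _) ujd).
have IH : forall q e, expectation (fun b => explore p d T b j u.+1 q e).
  by move=> q' e'; apply: IHj; rewrite addSnnS.
split; elim: q e => [|q IHq] e; try by move=> *; rewrite !explore0.
- move=> b b' bb'; rewrite !exploreE lerD// ler_wpM2l ?subr_ge0//;
    first exact: IHq.
  rewrite lerD// ler_wpM2l ?subr_ge0//; first exact: IHq.
  by apply: le => k; case: (IH (k + q)%N e) => + _ _; exact.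
- move=> a a' b b'; rewrite !exploreE !IHq.
  rewrite (_ : T _ = a * T (fun k => explore p d T b j u.+1 (k + q)%N e)
                   + a' * T (fun k => explore p d T b' j u.+1 (k + q)%N e)).
    by ring.
  rewrite -lin; congr T; apply/funext => k.
  by case: (IH (k + q)%N e) => _ -> _.
- rewrite !exploreE !IHq (_ : T _ = 1); first by ring.
  rewrite -[RHS]one; congr T; apply/funext => k.
  by case: (IH (k + q)%N e).
Qed.

Lemma returns_expectation p d m n : 0 <= p <= 1 -> (m <= d)%N ->
  expectation (returns p d m n).
Proof.
move=> p01 md; elim: n => [|n IHn] /=; first by split.
exact: explore_expectation.
Qed.

Lemma pgf_ge0 T x : expectation T -> 0 <= x -> 0 <= pgf T x.
Proof.
move=> ET x0; rewrite -[leLHS](expectation_const 0 ET).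
by apply: expectation_le => // k; rewrite exprn_ge0.
Qed.

Lemma pgf_le T x y : expectation T -> 0 <= x <= y -> pgf T x <= pgf T y.
Proof.
move=> ET /andP[x0 xy]; apply: expectation_le => // k.
by rewrite lerXn2r// nnegrE// (le_trans x0).
Qed.

(** Convexity of x ^ k between x and 1, with weight h at x. *)
Lemma power_convex (k : nat) x h : 0 <= x -> 0 <= h <= 1 ->
  (1 - h * (1 - x)) ^+ k <= 1 - h * (1 - x ^+ k).
Proof.
move=> x0 /andP[h0 h1]; elim: k => [|k IHk]; first by rewrite !expr0; lra.
have y0 : 0 <= 1 - h * (1 - x) by nra.
rewrite exprS; apply: le_trans (ler_wpM2l y0 IHk) _.
rewrite exprS.
have : 0 <= (1 - x) * (1 - x ^+ k).
  have [x1|x1] := lerP x 1.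
    by rewrite mulr_ge0 ?subr_ge0// exprn_ile1.
  by rewrite mulr_le0 ?subr_le0 ?exprn_ege1// ltW.
have : 0 <= h * (1 - h) by nra.
set z := x ^+ k; move=> A B; have := mulr_ge0 A B; nra.
Qed.

Lemma pgf_convex T x h : expectation T -> 0 <= x -> 0 <= h <= 1 ->
  pgf T (1 - h * (1 - x)) <= 1 - h * (1 - pgf T x).
Proof.
move=> ET x0 h01; case: (ET) => _ lin one.
have -> : 1 - h * (1 - pgf T x) = (1 - h) * 1 + h * pgf T x by ring.
rewrite -[X in _ * X + _]one -lin; apply: expectation_le => // k.
by apply: le_trans (power_convex k x0 h01) _; lra.
Qed.

(** If the returns from the children are ignored, the waiting frogs go up
    independently with probability p; returning frogs only increase the number
    of exits. *)
Lemma explore_le_thinned p d T x j u q e : 0 <= p <= 1 -> 0 <= x <= 1 ->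
  (u + j <= d)%N -> expectation T ->
  explore p d T (fun k => x ^+ k) j u q e <= x ^+ e * (1 - p + p * x) ^+ q.
Proof.
move=> /andP[p0 p1] /andP[x0 x1] + ET; set y := 1 - p + p * x.
have y0 : 0 <= y by rewrite /y; nra.
have y1 : y <= 1 by rewrite /y; nra.
elim: j u q e => [|j IHj] u q e ujd; elim: q e => [|q IHq] e; rewrite exploreE.
- by rewrite expr0 mulr1.
- have -> : x ^+ e * y ^+ q.+1 = p * (x ^+ e.+1 * y ^+ q)
      + (1 - p) * (x ^+ e * y ^+ q) by rewrite !exprS /y; ring.
  by rewrite lerD// ler_wpM2l ?subr_ge0// IHq.
- by rewrite expr0 mulr1.
- have /andP[f0 f1] := @fraction_itv d u (leq_trans (leq_addr _ _) ujd).
  have -> : x ^+ e * y ^+ q.+1 = p * (x ^+ e.+1 * y ^+ q) + (1 - p) *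
      ((u%:R / d%:R) * (x ^+ e * y ^+ q)
       + (1 - u%:R / d%:R) * (x ^+ e * y ^+ q)) by rewrite !exprS /y; ring.
  rewrite lerD// ler_wpM2l ?subr_ge0// ?IHq//.
  rewrite lerD// ler_wpM2l ?subr_ge0// ?IHq//.
  rewrite -[leRHS](expectation_const _ ET); apply: expectation_le => // k.
  apply: le_trans (IHj _ _ _ _) _; first by rewrite addSnnS.
  by rewrite exprD mulrA ler_wpM2r ?exprn_ge0// ler_piMr ?exprn_ge0//
    exprn_ile1.
Qed.

(** The right-hand side is a supermartingale along the exploration.  The first
    summand weighs each waiting frog by h and pays for the runs in which no
    frog is left waiting.  The second one pays for the runs in which the budget
    is exhausted: it would be a martingale for the thinning of
    explore_le_thinned, and each new child brings a further factor
    pgf T (1 - p + p * x), here paid in advance for the remaining j children. *)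
Lemma explore_le p d m T x h j u q e : 0 <= p <= 1 -> 0 <= x <= 1 ->
  (u + j <= m)%N -> (m <= d)%N -> expectation T -> 0 <= h ->
  p * x + (1 - p) * (m%:R / d%:R + pgf T h) <= h ->
  explore p d T (fun k => x ^+ k) j u q e <=
  x ^+ e * (h ^+ q + (1 - p + p * x) ^+ q * pgf T (1 - p + p * x) ^+ j).
Proof.
move=> p01 x01 + md ET h0 hle.
have /andP[p0 p1] := p01; have /andP[x0 x1] := x01.
set y := 1 - p + p * x; have y0 : 0 <= y by rewrite /y; nra.
set g := pgf T y; have g0 : 0 <= g by apply: pgf_ge0.
elim: j u q e => [|j IHj] u q e ujm.
  apply: le_trans (explore_le_thinned _ _ p01 x01 _ ET) _.
    exact: leq_trans ujm md.
  by rewrite expr0 mulr1 ler_wpM2l ?exprn_ge0// lerDr exprn_ge0.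
have ud : (u <= d)%N by apply: leq_trans md; apply: leq_trans ujm;
  apply: leq_addr.
have /andP[f0 f1] := @fraction_itv d u ud.
have fm : u%:R / d%:R <= m%:R / d%:R :> R.
  by rewrite ler_wpM2r// ler_nat (leq_trans _ ujm)// leq_addr.
elim: q e => [|q IHq] e; rewrite exploreE.
  by rewrite !expr0 mul1r mulrDr mulr1 lerDl mulr_ge0 ?exprn_ge0.
set f := u%:R / d%:R in f0 f1 fm *.
have TE : T (fun k => explore p d T (fun k => x ^+ k) j u.+1 (k + q)%N e) <=
    x ^+ e * (h ^+ q * pgf T h + y ^+ q * g ^+ j.+1).
  have -> : x ^+ e * (h ^+ q * pgf T h + y ^+ q * g ^+ j.+1) =
     (x ^+ e * h ^+ q) * pgf T h + (x ^+ e * y ^+ q * g ^+ j) * g.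
    by rewrite exprS; ring.
  case: (ET) => _ <- _; apply: expectation_le => // k.
  apply: le_trans (IHj _ _ _ _) _; first by rewrite addSnnS.
  by rewrite -/y -/g !exprD le_eqVlt; apply/orP; left; apply/eqP; ring.
have f1' : 0 <= 1 - f by rewrite subr_ge0.
have p1' : 0 <= 1 - p by rewrite subr_ge0.
have step := lerD (ler_wpM2l p0 (IHq e.+1))
  (ler_wpM2l p1' (lerD (ler_wpM2l f0 (IHq e)) (ler_wpM2l f1' TE))).
apply: (le_trans step).
have -> : p * (x ^+ e.+1 * (h ^+ q + y ^+ q * g ^+ j.+1)) +
  (1 - p) * (f * (x ^+ e * (h ^+ q + y ^+ q * g ^+ j.+1)) +
             (1 - f) * (x ^+ e * (h ^+ q * pgf T h + y ^+ q * g ^+ j.+1))) =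
  x ^+ e * (h ^+ q * (p * x + (1 - p) * (f + (1 - f) * pgf T h))
            + y ^+ q.+1 * g ^+ j.+1) by rewrite !exprS /y; ring.
rewrite ler_wpM2l ?exprn_ge0// lerD2r exprSr ler_wpM2l ?exprn_ge0//.
apply: le_trans hle; rewrite lerD2l ler_wpM2l// lerD// -[leRHS]mul1r.
by rewrite ler_wpM2r ?pgf_ge0// gerBl.
Qed.

Lemma pgf_returnsS p d m n x h : 0 <= p <= 1 -> 0 <= x <= 1 ->
  (m <= d)%N -> 0 <= h ->
  p * x + (1 - p) * (m%:R / d%:R + pgf (returns p d m n) h) <= h ->
  pgf (returns p d m n.+1) x <=
  h ^+ 2 + pgf (returns p d m n) (1 - p + p * x) ^+ m.
Proof.
move=> p01 x01 md h0 hle; have ET := returns_expectation n p01 md.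
apply: le_trans (explore_le (j := m) (u := 0) 2 0 p01 x01 (leqnn m) md ET h0
  hle) _.
have /andP[p0 p1] := p01; have /andP[x0 x1] := x01.
rewrite mul1r lerD2l ler_piMl ?exprn_ge0 ?pgf_ge0//; first by nra.
by rewrite exprn_ile1//; nra.
Qed.

Lemma pgf_returnsS_thinned p d m n x : 0 <= p <= 1 -> 0 <= x <= 1 ->
  (m <= d)%N -> pgf (returns p d m n.+1) x <= (1 - p + p * x) ^+ 2.
Proof.
move=> p01 x01 md; have ET := returns_expectation n p01 md.
by apply: le_trans (explore_le_thinned (j := m) (u := 0) 2 0 p01 x01 md ET) _;
  rewrite mul1r.
Qed.

End Exploration.

(** * The generating functions of the returns at drift 1/6 *)

Section CriticalNumerics.
Context {R : realType}.
Implicit Types (s t a : R).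

Let p : R := 6^-1.

Let p01 : 0 <= p <= 1.
Proof. by rewrite /p; lra. Qed.

(** The recursion of pgf_returnsS at x = 1 - s and h = 1 - t.  The error e
    comes from exhausting the budget m. *)
Lemma pgf_improve (d m n : nat) t a s (e : R) : (m <= d)%N ->
  0 <= t <= 1 -> 0 <= s <= 1 ->
  pgf (returns p d m n.+1) (1 - t) <= 1 - a ->
  6 * t - 5 * a + 5 * (m%:R / d%:R) <= s -> (1 - s / 36) ^+ m <= e ->
  pgf (returns p d m n.+2) (1 - s) <= 1 - (2 * t - t ^+ 2 - e).
Proof.
move=> md t01 s01 ta tas se.
have -> : 1 - (2 * t - t ^+ 2 - e) = (1 - t) ^+ 2 + e by ring.
apply: le_trans (pgf_returnsS (h := 1 - t) p01 _ md _ _) _; [lra|lra| |].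
  set k := m%:R / d%:R in tas *; set G := pgf _ _ in ta *.
  by rewrite /p; lra.
rewrite lerD2l; apply: le_trans se.
have -> : 1 - p + p * (1 - s) = 1 - s / 6 by rewrite /p; field.
have E := returns_expectation n.+1 p01 md.
rewrite lerXn2r// ?nnegrE; [by apply: pgf_ge0 => //; lra|lra|].
apply: le_trans (pgf_returnsS_thinned n p01 _ md) _; first lra.
by rewrite /p; nra.
Qed.

(** Up to the errors m / d and e, a slope a of 1 - G (1 - t) becomes the slope
    2 / (6 - 5 * a) at the scale (6 - 5 * a) * t, by pgf_improve.  Starting from
    the slope 1/3 of the thinned bound, eight iterations lead beyond 6/5.  The
    scale grows at most by 6 at each iteration, so that all of them stay between
    sigma and 6 ^+ 8 * sigma, where the quadratic terms are negligible. *)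
Lemma pgf_start (d m : nat) (sigma : R) : (m <= d)%N ->
  0 < sigma -> 6 ^+ 8 * sigma <= 200^-1 ->
  5 * (m%:R / d%:R) <= sigma / 100 -> (1 - sigma / 36) ^+ m <= sigma / 200 ->
  exists2 t, sigma <= t <= 200^-1 &
    pgf (returns p d m 9) (1 - t) <= 1 - 13 / 10 * t.
Proof.
move=> md sigma0 sigmaU kle mle.
have step n a b :
    (exists2 t, sigma <= t <= 6 ^+ n * sigma &
       pgf (returns p d m n.+1) (1 - t) <= 1 - a * t) ->
    b * (6 - 5 * a + 100^-1) <= 2 - 100^-1 -> 100^-1 <= 5 * a -> a <= 1 ->
    (n.+1 <= 8)%N ->
    exists2 t, sigma <= t <= 6 ^+ n.+1 * sigma &
      pgf (returns p d m n.+2) (1 - t) <= 1 - b * t.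
  move=> [t /andP[t1 t2] G] ab age ale n8.
  have t0 : 0 < t by apply: lt_le_trans t1.
  set r := 6 - 5 * a + 100^-1 in ab *.
  have r1 : 1 <= r by rewrite /r; lra.
  have r6 : r <= 6 by rewrite /r; lra.
  have s1 : sigma <= t * r by apply: le_trans t1 _; rewrite ler_peMr// ltW.
  have s2 : t * r <= 6 ^+ n.+1 * sigma.
    rewrite exprS -mulrA [leRHS]mulrC; apply: ler_pM => //; first exact: ltW.
    exact: le_trans r1.
  have s3 : t * r <= 200^-1.
    apply: le_trans s2 _; apply: le_trans sigmaU.
    by rewrite ler_wpM2r ?(ltW sigma0)// ler_weXn2l// ler1n.
  have t3 : t <= 200^-1 by apply: le_trans s3; rewrite ler_peMr// ltW.
  exists (t * r); first by rewrite s1.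
  have se : sigma / 200 <= t / 200 by rewrite ler_wpM2r ?invr_ge0.
  have tab : t * (b * r) <= t * (2 - 100^-1) by rewrite ler_wpM2l// ltW.
  have tt : t * t <= t * 200^-1 by rewrite ler_wpM2l// ltW.
  have tr : t * r = 6 * t - 5 * (a * t) + t / 100 by rewrite /r; ring.
  apply: le_trans (pgf_improve (e := sigma / 200) md _ _ G _ _) _.
  - by apply/andP; split; lra.
  - by apply/andP; split; lra.
  - by clear -kle t1 tr; lra.
  - by clear -mle s1 s3 sigma0; apply: le_trans mle; rewrite lerXn2r// ?nnegrE;
      lra.
  - clear -se tab tt; rewrite mulrCA in tab; rewrite expr2; lra.
have G1 : exists2 t, sigma <= t <= 6 ^+ 0 * sigma &
    pgf (returns p d m 1) (1 - t) <= 1 - 33 / 100 * t.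
  have s1 : sigma <= 200^-1.
    by apply: le_trans sigmaU; rewrite ler_peMl ?(ltW sigma0)// exprn_ege1//
      ler1n.
  exists sigma; first by rewrite mul1r lexx.
  apply: le_trans (pgf_returnsS_thinned 0 p01 _ md) _; first lra.
  clear -s1 sigma0; rewrite /p; nra.
(* The slopes are those of the iteration, rounded down to absorb the errors. *)
have G2 := step _ _ (45 / 100) G1 ltac:(lra) ltac:(lra) ltac:(lra) isT.
have G3 := step _ _ (52 / 100) G2 ltac:(lra) ltac:(lra) ltac:(lra) isT.
have G4 := step _ _ (58 / 100) G3 ltac:(lra) ltac:(lra) ltac:(lra) isT.
have G5 := step _ _ (63 / 100) G4 ltac:(lra) ltac:(lra) ltac:(lra) isT.
have G6 := step _ _ (69 / 100) G5 ltac:(lra) ltac:(lra) ltac:(lra) isT.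
have G7 := step _ _ (77 / 100) G6 ltac:(lra) ltac:(lra) ltac:(lra) isT.
have G8 := step _ _ (92 / 100) G7 ltac:(lra) ltac:(lra) ltac:(lra) isT.
have [t /andP[t1 t2] G9] := step _ _ (13 / 10) G8
  ltac:(lra) ltac:(lra) ltac:(lra) isT.
by exists t => //; rewrite t1 (le_trans t2).
Qed.

(** The slope 13/10 > 6/5 at t makes h = 1 - t admissible for every x <= 1.
    This gives the bound (1 - t) ^+ 2, which is better than 1 - 13 / 10 * t,
    plus an error that convexity controls at any scale s / 2, because the
    bound at s is the same for all s. *)
Lemma pgf_halve (d m n : nat) (sigma : R) t s : (m <= d)%N ->
  0 < sigma -> sigma <= t <= 200^-1 -> 0 <= s <= t ->
  5 * (m%:R / d%:R) <= sigma / 100 -> (1 - sigma / 36) ^+ m <= sigma / 200 ->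
  pgf (returns p d m n) (1 - s) <= 1 - 13 / 10 * t ->
  pgf (returns p d m n.+1) (1 - s / 2) <= 1 - 13 / 10 * t.
Proof.
move=> md sigma0 /andP[t1 t2] /andP[s0 s1] kle mle G;
  have E := returns_expectation n p01 md.
have Gt : pgf (returns p d m n) (1 - t) <= 1 - 13 / 10 * t.
  by apply: le_trans G; apply: pgf_le => //; lra.
apply: le_trans (pgf_returnsS (h := 1 - t) p01 _ md _ _) _; [lra|lra| |].
  set k := m%:R / d%:R in kle *; set g := pgf _ _ in Gt *.
  by rewrite /p; lra.
have -> : 1 - p + p * (1 - s / 2) = 1 - 12^-1 * (1 - (1 - s)).
  by rewrite /p; field.
have s1p : 0 <= 1 - s by clear -s1 t2; lra.
have t1p : 0 <= 1 - 12^-1 * (1 - (1 - s)) by clear -s1 t2; lra.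
have sg : 1 - 12^-1 * (13 / 10 * t) <= 1 - sigma / 36.
  by clear -t1 sigma0; lra.
have sg0 : 0 <= 1 - sigma / 36 by clear -t1 t2; lra.
have tt : t * t <= t * 200^-1.
  by rewrite ler_wpM2l// (le_trans _ t1)// ltW.
set g := pgf _ _.
have gle : g <= 1 - sigma / 36.
  have h01 : 0 <= (12^-1 : R) <= 1 by apply/andP; split; lra.
  apply: le_trans (pgf_convex E s1p h01) _; apply: le_trans sg.
  by rewrite lerD2l lerN2 ler_wpM2l ?invr_ge0// lerBrDl -lerBrDr.
have g0 : 0 <= g by apply: pgf_ge0.
have : g ^+ m <= sigma / 200.
  by apply: le_trans mle; rewrite lerXn2r// nnegrE.
clear -tt sigma0 t1 t2; set gm := g ^+ m; rewrite expr2; lra.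
Qed.

Lemma geometric_small (x e : R) : 0 <= x < 1 -> 0 < e ->
  exists k, x ^+ k <= e.
Proof.
move=> /andP[x0 x1] e0.
have : (fun k => x ^+ k) @ \oo --> (0 : R) by apply: cvg_expr;
  rewrite ger0_norm.
move=> /cvgrPdist_le /(_ e e0) /= [k _ /(_ k (leqnn k))] /=.
by rewrite sub0r normrN => H; exists k; apply: le_trans H; exact: ler_norm.
Qed.

(** As x tends to 1 along the bound Y, the number of returns is large with
    probability at least about 1 - Y; n depends on how large it has to be, but
    m, d and Y do not. *)
Lemma returns_large : exists m d0 : nat, forall d, (d0 <= d)%N ->
  (0 < d)%N /\ (m <= d)%N /\ exists2 Y : R, 0 <= Y < 1 &
  forall e : R, 0 < e -> exists n x,
    [/\ 1 - e <= x, 0 < x < 1 & pgf (returns p d m n) x <= Y].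
Proof.
pose sigma : R := (200 * 6 ^+ 8)^-1.
have sigma0 : 0 < sigma by rewrite invr_gt0 mulr_gt0// exprn_gt0.
have sigmaU : 6 ^+ 8 * sigma <= 200^-1.
  by rewrite /sigma invfM mulrCA mulfV ?mulr1// expf_neq0.
have sigma1 : sigma <= 1.
  apply: le_trans (le_trans (ler_peMl (ltW sigma0) _) sigmaU) _; last lra.
  by rewrite exprn_ege1// ler1n.
have [m mle] : exists m, (1 - sigma / 36) ^+ m <= sigma / 200.
  by apply: geometric_small; move: sigma0 sigma1; generalize sigma => z; lra.
set c := m%:R * 5 * 100 / sigma.
have c0 : 0 <= c by rewrite divr_ge0 ?mulr_ge0// ltW.
exists m, (m + Num.bound c)%N => d dle.
have md : (m <= d)%N by apply: leq_trans (leq_addr _ _) dle.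
have cd : c < d%:R.
  apply: lt_le_trans (archi_boundP c0) _; rewrite ler_nat.
  exact: leq_trans (leq_addl _ _) dle.
have d_gt0 : (0 < d)%N by rewrite -(ltr0n R); apply: le_lt_trans cd.
split=> //; split=> //.
have kle : 5 * (m%:R / d%:R) <= sigma / 100.
  rewrite mulrA ler_pdivrMr ?ltr0n//.
  move: cd; rewrite /c ltr_pdivrMr// => cd; lra.
have [t /andP[t1 t2] G9] := pgf_start md sigma0 sigmaU kle mle.
have t0 : 0 < t by apply: lt_le_trans t1.
clear sigmaU; clearbody sigma.
exists (1 - 13 / 10 * t); first by clear -t0 t2; lra.
move=> e e0.
have s01 k : 0 < t / 2 ^+ k <= t.
  rewrite divr_gt0 ?exprn_gt0//= ler_piMr ?(ltW t0)//.
  by rewrite invf_le1 ?exprn_gt0// exprn_ege1// ler1n.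
have G k : pgf (returns p d m (k + 9)) (1 - t / 2 ^+ k) <= 1 - 13 / 10 * t.
  elim: k => [|k IHk]; first by rewrite expr0 divr1.
  rewrite exprSr invfM mulrA; apply: (pgf_halve (sigma := sigma)) => //;
    first by rewrite t1.
  by case/andP: (s01 k) => /ltW ->.
have [k ke] : exists k, (2^-1 : R) ^+ k <= e.
  by apply: geometric_small => //; apply/andP; split; lra.
have ks : t / 2 ^+ k <= e.
  apply: le_trans ke; rewrite exprVn ler_piMl ?invr_ge0 ?exprn_ge0//.
  by clear -t2; lra.
have /andP[k0 kt] := s01 k.
exists (k + 9)%N, (1 - t / 2 ^+ k); split=> //; first by rewrite lerD2l lerN2.
rewrite subr_gt0 gtrBl k0 (le_lt_trans kt)//.
by clear -t2; lra.
Qed.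

End CriticalNumerics.

(** * A one-player game *)

Section States.
Context {d : nat}.
Implicit Types (s J : seq (vertex d * vertex d)) (w x y z a : vertex d).

(** A state of the game lists the awake frogs, named by their starting
    vertices, with their current positions. The starting vertices are also the
    vertices seen so far, and they form a connected subtree. *)
Definition well_formed s :=
  [/\ uniq (unzip1 s),
      forall i u, i :: u \in unzip1 s -> u \in unzip1 s &
      forall e, e \in s -> e.2 \in unzip1 s].

Definition arrive w y s :=
  if y \in w :: unzip1 s then (w, y) :: s else [:: (y, y), (w, y) & s].

Definition at_root s := count (fun e => e.2 == tree_root d) s.

Lemma unseen_subtree s v z : well_formed s -> v \notin unzip1 s ->
  suffix v z -> z \notin unzip1 s.
Proof.
move=> [_ closed _] vs /suffixP[t ->].
by elim: t => //= i t; apply: contra; exact: closed.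
Qed.

End States.

(** fail s b is meant to say that, given any revealed beginnings of the walks
    that lead to the state s, fewer than M moves to the root occur with
    conditional probability at most b.  In fail_win, one of the frogs at the
    root may be the one that started there, hence the strict inequality.  In
    fail_move and fail_leave, the player has chosen to move the frog w. *)
Record failure_rules {R : realType} {d : nat} (p : R) (M : nat)
    (fail : seq (vertex d * vertex d) -> R -> Prop) : Prop := FailureRules {
  fail_perm : forall s s' b, perm_eq s s' -> fail s b -> fail s' b;
  fail_le : forall s b b', b <= b' -> fail s b -> fail s b';
  fail_wf : forall s b, (well_formed s -> fail s b) -> fail s b;
  fail_one : forall s, fail s 1;
  fail_win : forall s, (M < at_root s)%N -> fail s 0;
  fail_move : forall w i u s b0 (b : 'I_d -> R),
    fail (arrive w u s) b0 ->
    (forall j, fail (arrive w [:: j, i & u] s) (b j)) ->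
    fail ((w, i :: u) :: s) (p * b0 + (1 - p) * ((\sum_j b j) / d%:R));
  fail_leave : forall w s (b : 'I_d -> R),
    (forall j, fail (arrive w [:: j] s) (b j)) ->
    fail ((w, [::]) :: s) ((\sum_j b j) / d%:R) }.

Ltac solve_perm :=
  apply/permP => ?; rewrite /=; repeat rewrite (count_cat, map_cat) /=; ring.

Ltac solve_mem :=
  rewrite /unzip1 ?map_cat /= !(inE, mem_cat) /=;
  repeat match goal with
  | |- context [?z \in ?A] => case: (z \in A) => //=
  | |- context [?z == ?y] => case: (z == y) => //=
  end.

Section Strategy.
Context {R : realType} {d : nat} {p : R} {M : nat}.
Context {fail : seq (vertex d * vertex d) -> R -> Prop}.
Context (rules : failure_rules p M fail).
Context (d_gt0 : (0 < d)%N).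
Implicit Types (s J : seq (vertex d * vertex d)) (w x y z a v : vertex d).

Let d_neq0 : d%:R != 0 :> R.
Proof. by rewrite pnatr_eq0 -lt0n. Qed.

Lemma fail_up_down w i u s b0 b1 :
  fail ((w, u) :: s) b0 ->
  (forall j, fail (arrive w [:: j, i & u] s) b1) ->
  fail ((w, i :: u) :: s) (p * b0 + (1 - p) * b1).
Proof.
move=> f0 f1; apply: (fail_wf rules) => -[_ closed pos].
have -> : b1 = (\sum_(j < d) b1) / d%:R.
  by rewrite sumr_const card_ord -[b1 *+ d]mulr_natr mulfK.
apply: (fail_move rules) => //.
have xin := pos (w, i :: u) (mem_head _ _).
by rewrite /arrive -[_ :: _]/(unzip1 ((w, i :: u) :: s)) (closed i).
Qed.

(** Playing below the vertex i :: u, just entered by frog a, leads to a state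
    in which the frogs L are at the parent u, L has a size of law T, the frogs
    in J are anywhere, and the part s of the state is untouched.  Recording that
    the frogs in L and J other than a come from the subtree of i :: u, and that
    i :: u is one of them, is what lets the play at u count its used children
    and find the other ones unseen. *)
Definition plays (T : (nat -> R) -> R) := forall i u s a b,
  (forall z, suffix (i :: u) z -> z \notin a :: unzip1 s) ->
  (forall L J,
    (forall z, ~~ suffix (i :: u) z -> (z \in L ++ unzip1 J) = (z == a)) ->
    i :: u \in L ++ unzip1 J ->
    fail ([seq (w, u) | w <- L] ++ J ++ s) (b (size L))) ->
  fail [:: (i :: u, i :: u), (a, i :: u) & s] (T b).

Lemma suffix_behead (j : 'I_d) v : suffix v (j :: v).
Proof. by rewrite -cat1s suffix_suffix. Qed.

Lemma suffix_child (j : 'I_d) v z : suffix (j :: v) z -> suffix v z.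
Proof. by move=> /suffixP[t ->]; rewrite -cat_rcons suffix_suffix. Qed.

Lemma suffix_sibling (j k : 'I_d) v :
  suffix (j :: v) (k :: v) = (j == k).
Proof.
apply/idP/eqP => [|->]; last exact: suffix_refl.
move=> /suffixP[[|l t]]; first by case.
by move=> /(congr1 size); rewrite /= size_cat /=; lia.
Qed.

Lemma suffix_parent (j : 'I_d) v : ~~ suffix (j :: v) v.
Proof. by apply/negP => /size_suffix /=; rewrite ltnn. Qed.

(** One round of the exploration: Q are the frogs waiting at i :: u, X those
    that have gone up to u, J the abandoned ones.  The number k of used
    children matters only as long as the budget j is not exhausted. *)
Lemma plays_explore T b i u s a : plays T ->
  (forall z, suffix (i :: u) z -> z \notin a :: unzip1 s) ->
  (forall L J,
    (forall z, ~~ suffix (i :: u) z -> (z \in L ++ unzip1 J) = (z == a)) ->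
    i :: u \in L ++ unzip1 J ->
    fail ([seq (w, u) | w <- L] ++ J ++ s) (b (size L))) ->
  forall j k Q X J,
  (forall z, ~~ suffix (i :: u) z ->
     (z \in Q ++ X ++ unzip1 J) = (z == a)) ->
  i :: u \in Q ++ X ++ unzip1 J ->
  (j = 0 \/ #|[pred c : 'I_d | c :: i :: u \in Q ++ X ++ unzip1 J]| = k)%N ->
  fail ([seq (w, i :: u) | w <- Q] ++ [seq (w, u) | w <- X] ++ J ++ s)
       (explore p d T b j k (size Q) (size X)).
Proof.
set v := i :: u => playT fresh done.
elim=> [|j IHj] k Q; move sQ : (size Q) => q.
  elim: q Q sQ => [|q IHq] [|w Q]// => [_|[sQ]] X J out vin _.
    by rewrite explore0; apply: done.
  rewrite exploreE; apply: fail_up_down => [|c].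
    apply: (fail_perm rules) (IHq Q sQ (w :: X) J _ _ _) => //; last by left.
    - by solve_perm.
    - by move=> z /out <-; solve_mem.
    - by move: vin; solve_mem.
  have sub z : ~~ suffix v z -> (z == c :: v) = false.
    by apply: contraNF => /eqP ->; rewrite suffix_behead.
  rewrite /arrive; case: ifP => _.
    apply: (fail_perm rules) (IHq Q sQ X ((w, c :: v) :: J) _ _ _) => //;
      last by left.
    - by solve_perm.
    - by move=> z /out <-; solve_mem.
    - by move: vin; solve_mem.
  apply: (fail_perm rules) (IHq Q sQ X [:: (c :: v, c :: v), (w, c :: v) & J] _
    _ _) => //; last by left.
  - by solve_perm.
  - by move=> z zv; rewrite -(out z zv); move: (sub z zv); solve_mem.
  - by move: vin; solve_mem.
elim: q Q sQ => [|q IHq] [|w Q]// => [_|[sQ]] X J out vin [//|used].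
  by rewrite explore0; apply: done.
rewrite exploreE; apply: (fail_wf rules) => wf.
set A := (w :: Q) ++ X ++ unzip1 J in out vin used.
set st := _ ++ _ in wf *.
have Ast z : suffix v z -> (z \in unzip1 st) = (z \in A).
  move=> vz; have := fresh z vz; rewrite /st /A.
  rewrite /unzip1 !map_cat -!map_comp !map_id /= !(inE, mem_cat) negb_or =>
    /andP[_].
  by case: (z \in unzip1 s); rewrite ?orbF.
have vst : v \in unzip1 st by rewrite Ast ?suffix_refl.
have [_ closed pos] := wf.
have ust : u \in unzip1 st by apply: closed vst.
have sub c z : ~~ suffix v z -> ~~ suffix (c :: v) z.
  by apply: contra; exact: suffix_child.
set x1 := explore p d T b j.+1 k q (size X).
set x2 := T (fun l => explore p d T b j k.+1 (l + q)%N (size X)).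
(* The step to a uniform child averages x1 over the k used children and x2 over
   the d - k unseen ones. *)
pose beta (c : 'I_d) := if c :: v \in A then x1 else x2.
have cardC : #|[pred c : 'I_d | c :: v \notin A]| = (d - k)%N.
  have := cardC [pred c : 'I_d | c :: v \in A].
  by rewrite used card_ord => /(congr1 (subn^~ k)) /=; rewrite addKn => <-.
have kd : (k <= d)%N by rewrite -used (leq_trans (max_card _))// card_ord.
have -> : k%:R / d%:R * x1 + (1 - k%:R / d%:R) * x2 = (\sum_c beta c) / d%:R.
  have -> : \sum_c beta c = k%:R * x1 + (d%:R - k%:R) * x2.
    rewrite (bigID (fun c => c :: v \in A))/= -natrB//; congr (_ + _).
      rewrite (eq_bigr (fun=> x1)); last by move=> c cA; rewrite /beta cA.
      by rewrite sumr_const used mulr_natl.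
    rewrite (eq_bigr (fun=> x2)); last by move=> c /negbTE cA; rewrite /beta cA.
    by rewrite sumr_const cardC mulr_natl.
  by field.
apply: (fail_move rules) => [|c].
  rewrite /arrive -[X in _ \in X]/(unzip1 st) ust.
  apply: (fail_perm rules) (IHq Q sQ (w :: X) J _ _ _) => //.
  - by solve_perm.
  - by move=> z /out <-; rewrite /A; solve_mem.
  - by move: vin; rewrite /A; solve_mem.
  - right; rewrite -used; apply: eq_card => c; rewrite !inE /A; solve_mem.
rewrite /arrive -[X in _ \in X]/(unzip1 st) Ast; last by rewrite suffix_behead.
rewrite /beta; case: ifPn => cA.
  apply: (fail_perm rules) (IHq Q sQ X ((w, c :: v) :: J) _ _ _) => //.
  - by solve_perm.
  - by move=> z /out <-; rewrite /A; solve_mem.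
  - by move: vin; rewrite /A; solve_mem.
  - right; rewrite -used; apply: eq_card => c'; rewrite !inE /A; solve_mem.
apply: playT => [z cz|L J' out' cin].
  rewrite -[X in _ \in X]/(unzip1 st); apply: (unseen_subtree wf) cz.
  by rewrite Ast// suffix_behead.
have AE z : ~~ suffix (c :: v) z ->
    (z \in (L ++ Q) ++ X ++ unzip1 (J' ++ J)) = (z \in A).
  by move=> /out'; rewrite /A; solve_mem.
apply: (fail_perm rules)
  (_ : fail (map _ (L ++ Q) ++ map _ X ++ (J' ++ J) ++ s) _).
  by rewrite map_cat; solve_perm.
rewrite -sQ -size_cat; apply: IHj.
- by move=> z zv; rewrite AE ?sub// out.
- by rewrite AE// suffix_parent.
right; rewrite -used (cardD1 c) [X in _ = X.+1](cardD1 c).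
rewrite -[X in _ = (nat_of_bool X + _).+1]/(c :: v \in A) (negbTE cA).
set B := (L ++ Q) ++ _ in AE *.
rewrite -[X in (nat_of_bool X + _)%N = _]/(c :: v \in B).
have -> : c :: v \in B by move: cin; rewrite /B; solve_mem.
rewrite add1n add0n; congr S; apply: eq_card => c'; rewrite !inE.
by case: eqVneq => //= c'c; rewrite AE// suffix_sibling eq_sym.
Qed.

Lemma plays_returns m n : plays (returns p d m n).
Proof.
have start (i : 'I_d) u a z :
    ~~ suffix (i :: u) z -> (z \in [:: i :: u; a]) = (z == a).
  by move=> zv; rewrite !inE; case: eqP zv => //= ->; rewrite suffix_refl.
elim: n => [|n IHn] i u s a b fresh done.
  apply: (done [::] [:: (i :: u, i :: u); (a, i :: u)]) => [z|].
    exact: start.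
  by rewrite mem_head.
apply: (plays_explore IHn fresh done (Q := [:: i :: u;
  a]) (X := [::]) (J := [::])).
- by move=> z; exact: start.
- by rewrite mem_head.
- right; apply: eq_card0 => c; rewrite !inE.
  have := fresh _ (suffix_behead c _); rewrite inE negb_or => /andP[/negbTE ->
    _].
  by rewrite orbF; apply/eqP => /(congr1 size)/eqP /=; rewrite gtn_eqF.
Qed.

Lemma fail_straight_up x w s b1 b2 :
  fail ((w, tree_root d) :: s) b1 ->
  (forall y J, fail ((w, y) :: J ++ s) b2) ->
  fail ((w, x) :: s) (p ^+ size x * b1 + (1 - p ^+ size x) * b2).
Proof.
move=> f1 f2; elim: x => [|i u IHu].
  by apply: (fail_le rules) f1; rewrite expr0 mul1r subrr mul0r addr0.
rewrite (_ : _ + _ = p * (p ^+ size u * b1 + (1 - p ^+ size u) * b2)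
                    + (1 - p) * b2); last by rewrite exprS; ring.
apply: fail_up_down => // j; rewrite /arrive; case: ifP => _.
  exact: (f2 _ [::]).
apply: (fail_perm rules) (f2 [:: j, i & u] [:: ([:: j, i & u], [:: j, i & u])]).
by solve_perm.
Qed.

(** Each frog at u tries to go straight to the root, which succeeds with
    probability p ^+ size u, and is abandoned otherwise.  The bound is Markov's
    inequality for 2^-1 raised to the number of frogs at the root. *)
Lemma fail_bring_home u L s : 0 <= p <= 1 ->
  fail ([seq (w, u) | w <- L] ++ s)
    (2 ^+ M.+1 * 2^-1 ^+ at_root s * (1 - p ^+ size u / 2) ^+ size L).
Proof.
move=> /andP[p0 p1]; set g := 1 - _.
have q0 : 0 <= p ^+ size u by exact: exprn_ge0.
have q1 : p ^+ size u <= 1 by exact: exprn_ile1.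
have g0 : 0 <= g by rewrite /g; lra.
elim: L s => [|w L IHL] s.
  rewrite expr0 mulr1; have [Ms|sM] := ltnP M (at_root s).
    apply: (fail_le rules) (fail_win rules Ms).
    by rewrite mulr_ge0// exprn_ge0.
  apply: (fail_le rules) (fail_one rules _) => /=.
  by rewrite exprVn ler_pdivlMr ?exprn_gt0// mul1r ler_weXn2l ?ler1n// ltnW.
set C : R := 2 ^+ M.+1 in IHL *.
have C0 : 0 <= C by exact: exprn_ge0.
have gL0 : 0 <= g ^+ size L by exact: exprn_ge0.
rewrite map_cons cat_cons.
apply: (fail_le rules _ (fail_straight_up u
  (b1 := C * 2^-1 ^+ (at_root s).+1 * g ^+ size L)
  (b2 := C * 2^-1 ^+ at_root s * g ^+ size L) _ _)).
- by rewrite le_eqVlt; apply/orP; left; apply/eqP; rewrite !exprS /g; field.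
- apply: (fail_le rules _ (fail_perm rules _ (IHL ((w, tree_root d) :: s)))).
    by rewrite /at_root.
  by solve_perm.
- move=> y J; apply: (fail_le rules _ (fail_perm rules _ (IHL ((w, y) :: J ++
    s)))).
    rewrite ler_wpM2r// ler_wpM2l// ler_wiXn2l ?invr_ge0 ?invf_le1 ?ler1n//.
    by rewrite /at_root /= count_cat addnA leq_addl.
  by solve_perm.
Qed.

(** While only seen vertices are visited, the depth of the walk is at most D.
    The mean of 2^-1 ^+ depth shrinks by (1 + 3 * p) / 2 at each step away from
    the root, and by 1/2 <= (1 + 3 * p) / 2 at the root, so that for p < 1/3 a
    single frog soon finds an unseen vertex. *)
Lemma fail_walk_to_unseen (c : R) (D N : nat) w x s : 0 <= p <= 1 -> 0 <= c ->
  (forall z, z \in w :: unzip1 s -> (size z <= D)%N) ->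
  (forall i u, i :: u \notin w :: unzip1 s ->
     fail [:: (i :: u, i :: u), (w, i :: u) & s] c) ->
  fail ((w, x) :: s) (c + ((1 + 3 * p) / 2) ^+ N * 2 ^+ D * 2^-1 ^+ size x).
Proof.
move=> /andP[p0 p1] c0 deep unseen.
set l := (1 + 3 * p) / 2; have l0 : 2^-1 <= l by rewrite /l; lra.
have C0 k : 0 <= l ^+ k * 2 ^+ D.
  by rewrite mulr_ge0 ?exprn_ge0// (le_trans _ l0)// invr_ge0.
have next k y j : fail ((w, j :: y) :: s) (c + l ^+ k * 2 ^+ D * 2^-1 ^+ (size
  y).+1) ->
    fail (arrive w (j :: y) s) (c + l ^+ k * 2 ^+ D * 2^-1 ^+ (size y).+1).
  rewrite /arrive; case: ifPn => // jy _; apply: (fail_le rules) (unseen _ _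
    jy).
  by rewrite lerDl mulr_ge0// exprn_ge0// invr_ge0.
elim: N x => [|N IHN] x.
  apply: (fail_wf rules) => -[_ _ pos].
  have xD : (size x <= D)%N by apply: deep; exact: (pos (w, x) (mem_head _ _)).
  apply: (fail_le rules) (fail_one rules _).
  rewrite expr0 mul1r exprVn (le_trans (y := 2 ^+ D / 2 ^+ size x))//.
    by rewrite ler_pdivlMr ?exprn_gt0// mul1r ler_weXn2l// ler1n.
  by rewrite lerDr.
have CN := C0 N; set C := l ^+ N * 2 ^+ D in IHN next CN *.
have -> : l ^+ N.+1 * 2 ^+ D = l * C by rewrite exprS /C mulrA.
case: x => [|i u].
  have child j : fail (arrive w [:: j] s) (c + C * 2^-1).
    by rewrite -[X in C * X]expr1; apply: next; apply: IHN.
  apply: (fail_le rules _ (fail_leave rules child)).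
  rewrite sumr_const card_ord -[_ *+ d]mulr_natr mulfK// expr0 mulr1 lerD2l.
  by rewrite mulrC ler_wpM2r.
have u0 : 0 <= 2^-1 ^+ size u :> R by rewrite exprn_ge0// invr_ge0.
apply: (fail_le rules _ (fail_up_down (b0 := c + C * 2^-1 ^+ size u)
  (b1 := c + C * 2^-1 ^+ (size u).+2) (IHN u) (fun j => next _ _ _ (IHN [:: j,
    i & u])))).
rewrite /= !exprS; set h := 2^-1 ^+ size u; rewrite le_eqVlt; apply/orP; left.
by apply/eqP; rewrite /l; field.
Qed.

Lemma bernoulli_inequality (e : R) k : 0 <= e <= 1 -> 1 - k%:R * e <= (1 - e)
  ^+ k.
Proof.
move=> /andP[e0 e1]; elim: k => [|k IHk]; first by rewrite expr0 mul0r subr0.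
rewrite exprS; apply: le_trans (ler_wpM2l _ IHk); last by rewrite subr_ge0.
rewrite -natr1 mulrDl mul1r; have : 0 <= k%:R * e * e by rewrite !mulr_ge0.
by set f := k%:R * e; nra.
Qed.

(** One attempt: walk to an unseen vertex i :: u, play below it, and bring the
    returned frogs home.  Conditionally on K returns or more the attempt fails
    with small probability; with fewer returns, which by Markov's inequality
    for z ^+ k has probability at most about Y, one falls back on the bound
    beta for the state reached. *)
Lemma fail_shrink (Y beta : R) m : 0 < p -> p < 3^-1 -> (m <= d)%N ->
  0 <= Y < 1 ->
  (forall e : R, 0 < e -> exists n (x : R),
    [/\ 1 - e <= x, 0 < x < 1 & pgf (returns p d m n) x <= Y]) ->
  0 < beta -> (forall s, s != [::] -> fail s beta) ->
  forall s, s != [::] -> fail s (beta * ((1 + Y) / 2)).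
Proof.
move=> p0 p3 md /andP[Y0 Y1] large beta0 all_fail.
have p01 : 0 <= p <= 1 by apply/andP; split; lra.
have be0 : 0 < beta * (1 - Y) / 8 by rewrite divr_gt0// mulr_gt0// subr_gt0.
case=> // -[w x] s _; apply: (fail_wf rules) => wf.
pose D := \max_(z <- w :: unzip1 s) size z.
have [N Nle] : exists N, ((1 + 3 * p) / 2) ^+ N <= beta * (1 - Y) / 8 / 2 ^+ D.
  apply: geometric_small; first by apply/andP; split; lra.
  by rewrite divr_gt0// exprn_gt0.
set c := beta * ((1 - Y) / 8 + (1 + 3 * Y) / 4).
have c0 : 0 <= c by rewrite mulr_ge0 ?(ltW beta0)//; lra.
apply: (fail_le rules _ (fail_walk_to_unseen (c := c) (D := D) N x p01 c0 _ _)).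
- have -> : beta * ((1 + Y) / 2) = c + beta * (1 - Y) / 8 by rewrite /c; field.
  have l0 : 0 <= (1 + 3 * p) / 2 by lra.
  have h1 : 2^-1 ^+ size x <= 1 :> R.
    by rewrite exprn_ile1// ?invr_ge0// invf_le1// ler1n.
  rewrite lerD2l (le_trans (ler_piMr _ h1))//;
    first by rewrite mulr_ge0 ?exprn_ge0.
  by rewrite -ler_pdivlMr ?exprn_gt0.
- by move=> z zs; apply: leq_bigmax_seq.
move=> i u iu.
have q1 : p ^+ size u <= 1 by rewrite exprn_ile1// ltW//; lra.
have q0 : 0 < p ^+ size u by rewrite exprn_gt0.
have [K Kle] : exists K, (1 - p ^+ size u / 2) ^+ K <= beta * (1 - Y) / 8 / 2
  ^+ M.+1.
  apply: geometric_small; first by apply/andP; split; lra.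
  by rewrite divr_gt0// exprn_gt0.
(* e is such that z >= 1 - e makes z ^+ K exceed 1 - (1 - Y) / 4. *)
pose e : R := (1 - Y) / (4 * K.+1%:R).
have K0 : 0 < 4 * K.+1%:R :> R by rewrite mulr_gt0// ltr0n.
have e0 : 0 < e by rewrite divr_gt0// subr_gt0.
have eK : K%:R * e <= (1 - Y) / 4.
  rewrite /e mulrCA ler_wpM2l ?subr_ge0 ?(ltW Y1)//.
  by rewrite ler_pdivrMr// mulrA mulVf// mul1r ler_nat.
have e1 : e <= 1.
  rewrite ler_pdivrMr// mul1r (@le_trans _ _ 4)//; first lra.
  by rewrite ler_peMr// ler1n.
have [n [z [ez /andP[z0 z1] Gz]]] := large e e0.
have zK : (1 + 3 * Y) / 4 >= Y / z ^+ K.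
  rewrite ler_pdivrMr ?exprn_gt0//.
  have : 1 - (1 - Y) / 4 <= z ^+ K.
    apply: (@le_trans _ _ (1 - K%:R * e)); first by rewrite lerD2l lerN2.
    apply: le_trans (bernoulli_inequality _ _) _; first by rewrite e1 ltW.
    by rewrite lerXn2r// nnegrE ?subr_ge0// ltW.
  by move: (z ^+ K) => zK H; nra.
(* The first summand covers k >= K; the second is at least beta for k < K. *)
pose b k : R := beta * ((1 - Y) / 8) * 1 + beta / z ^+ K * z ^+ k.
have ET := returns_expectation n p01 md.
have bz0 : 0 <= beta / z ^+ K by rewrite divr_ge0 ?exprn_ge0// ltW.
apply: (fail_le rules (b := returns p d m n b)).
  case: (ET) => _ lin one; rewrite lin one mulr1.
  apply: le_trans (lerD (lexx _) (ler_wpM2l bz0 Gz)) _.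
  rewrite /c mulrDr lerD2l -mulrA ler_wpM2l ?(ltW beta0)//.
  by rewrite mulrC.
apply: plays_returns => [v vu|L J _ uin].
  exact: (unseen_subtree (s := (w, x) :: s)) vu.
have [KL|LK] := leqP K (size L).
  apply: (fail_le rules _ (fail_bring_home _ _ _ p01)).
  apply: (@le_trans _ _ (beta * ((1 - Y) / 8))); last first.
    by rewrite /b mulr1 lerDl mulr_ge0// exprn_ge0// ltW.
  have g0 : 0 <= 1 - p ^+ size u / 2 by lra.
  have g1 : 1 - p ^+ size u / 2 <= 1 by lra.
  apply: (@le_trans _ _ (2 ^+ M.+1 * (1 - p ^+ size u / 2) ^+ K)).
    apply: ler_pM; rewrite ?mulr_ge0 ?exprn_ge0 ?invr_ge0//.
      by rewrite ler_piMr ?exprn_ge0// exprn_ile1// ?invr_ge0// invf_le1//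
        ler1n.
    exact: ler_wiXn2l.
  by rewrite mulrC -ler_pdivlMr ?exprn_gt0// mulrA.
apply: (fail_le rules _ (all_fail _ _)); last first.
  by case: L uin LK => //; case: J.
rewrite /b mulr1 -[leLHS]add0r lerD//.
  by rewrite mulr_ge0 ?(ltW beta0)// divr_ge0// subr_ge0 ltW.
rewrite -mulrA ler_peMr ?(ltW beta0)// mulrC ler_pdivlMr ?exprn_gt0// mul1r.
by rewrite ler_wiXn2l ?(ltW z0) ?(ltW z1) ?(ltnW LK).
Qed.

Lemma fail_arbitrarily_small (Y : R) m : 0 < p -> p < 3^-1 -> (m <= d)%N ->
  0 <= Y < 1 ->
  (forall e : R, 0 < e -> exists n (x : R),
    [/\ 1 - e <= x, 0 < x < 1 & pgf (returns p d m n) x <= Y]) ->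
  forall e, 0 < e -> forall s, s != [::] -> fail s e.
Proof.
move=> p0 p3 md Y01 large e e0.
have [k ke] : exists k, ((1 + Y) / 2) ^+ k <= e.
  by apply: geometric_small => //; case/andP: Y01 => *; apply/andP; split; lra.
have Yk j : 0 < ((1 + Y) / 2) ^+ j.
  by rewrite exprn_gt0// divr_gt0// ltr_wpDr//; case/andP: Y01.
suff H j s : s != [::] -> fail s (((1 + Y) / 2) ^+ j).
  by move=> s s0; apply: (fail_le rules ke); exact: H.
elim: j s => [|j IHj] s s0; first by rewrite expr0; exact: (fail_one rules).
by rewrite exprSr; apply: fail_shrink Y01 large (Yk j) IHj s s0.
Qed.

End Strategy.

(** * Waking does not depend on the order of the moves *)

Section Awakening.
Context {d : nat} (s : vertex d -> nat -> vertex d).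
Implicit Types (t k : nat) (u v : vertex d).

Definition awake v := exists t k, steps_made s t v = Some k.

Lemma awake_root : awake (tree_root d).
Proof. by exists 0%N, 0%N. Qed.

Lemma steps_madeD t v k j :
  steps_made s t v = Some k -> steps_made s (t + j) v = Some (k + j)%N.
Proof.
move=> tv; elim: j => [|j IHj]; first by rewrite !addn0.
by rewrite !addnS /= IHj.
Qed.

Lemma steps_made0 t v k :
  steps_made s t v = Some k -> exists t0, steps_made s t0 v = Some 0%N.
Proof.
elim: t k => [|t IHt] k /= tv.
  by exists 0%N => /=; case: ifP tv.
case E: (steps_made s t v) tv => [k'|] tv; first exact: IHt E.
by exists t.+1; rewrite /= E; case: ifP tv.
Qed.

Lemma awake_step v k : awake v -> exists t, steps_made s t v = Some k.
Proof.
by move=> [t [k' /steps_made0[t0 E]]]; exists (t0 + k)%N;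
  rewrite (steps_madeD _ E).
Qed.

Lemma awake_visited u k : awake u -> awake (s u k.+1).
Proof.
move=> /(@awake_step u k)[t E]; set v := s u k.+1.
case Ev: (steps_made s t v) => [k'|]; first by exists t, k'.
exists t.+1, 0%N; rewrite /= Ev asboolT//.
by exists u, k.
Qed.

Definition root_moves_ge (M : nat) := exists l : seq (nat * vertex d),
  [/\ size l = M, uniq l & forall x, x \in l -> root_moves s x].

(** A frog that is ever woken makes all the steps of its walk at some time, so
    the visits to the root may be counted without looking at the clock. *)
Lemma root_moves_ge_distinct M (l : seq (vertex d)) : (M <= size l)%N ->
  uniq l -> (forall v, v \in l -> exists2 k, awake v & s v k.+1 = tree_root d)
    ->
  root_moves_ge M.
Proof.
move=> Ml ul visit.
have [l' [El Hl]] : exists l' : seq (nat * vertex d),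
    unzip2 l' = l /\ forall x, x \in l' -> root_moves s x.
  elim: l visit {ul Ml} => [|v l IHl] visit; first by exists [::].
  have [|l' [El Hl]] := IHl; first by move=> u ul; apply: visit;
    rewrite inE ul orbT.
  have [k /(@awake_step v k)[t E] vk] := visit v (mem_head _ _).
  exists ((t, v) :: l'); split; first by rewrite /= El.
  by move=> x /predU1P[->|/Hl//]; exists k.
exists (take M l'); split.
- by rewrite size_takel// -(size_map snd) -/(unzip2 l') El.
- by apply: take_uniq; apply: (@map_uniq _ _ snd); rewrite -/(unzip2 l') El.
- by move=> x /mem_take/Hl.
Qed.

Lemma root_visits_infinite (R : realType) :
  root_visits s R = +oo%E <-> forall M, root_moves_ge M.
Proof.
rewrite /root_visits /counting; split.
  case: asboolP => // inf _ M.
  have [B BA MB] := infinite_set_fset M inf.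
  exists (take M (enum_fset B)); split.
  - by rewrite size_takel.
  - by rewrite take_uniq// fset_uniq.
  - by move=> x /mem_take xB; apply: BA.
move=> ge; case: asboolP => // fin.
have [l [sl ul lA]] := ge (#|` fset_set (root_moves s)|).+1.
suff : (size l <= #|` fset_set (root_moves s)|)%N by rewrite sl ltnn.
apply: uniq_leq_size => // x /lA xA.
by rewrite in_fset_set//; apply/mem_set.
Qed.

End Awakening.

(** * Measurability of the number of root visits *)

Section Measurability.
Context {disp : measure_display} {T : measurableType disp} {d : nat}.
Context {S : vertex d -> nat -> T -> vertex d}.
Context (mS : forall v n x, measurable [set w | S v n w = x]).

Lemma measurable_exists (I : countType) (F : I -> T -> Prop) :
  (forall i, measurable [set w | F i w]) ->
  measurable [set w | exists i, F i w].
Proof.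
move=> mF; rewrite [X in measurable X](_ : _ = \bigcup_i [set w | F i w]).
  exact: countable_bigcupT_measurable.
by apply/seteqP; split=> w /= [i]; exists i.
Qed.

Lemma measurable_and (F G : T -> Prop) :
  measurable [set w | F w] -> measurable [set w | G w] ->
  measurable [set w | F w /\ G w].
Proof. exact: measurableI. Qed.

Lemma measurable_steps_made t v o :
  measurable [set w | steps_made (fun v n => S v n w) t v = o].
Proof.
elim: t v o => [|t IHt] v o /=.
  have [->|no] := pselect ((if v == tree_root d then Some 0%N else None) = o).
    by rewrite [X in measurable X](_ : _ = setT)//; apply/seteqP; split.
  by rewrite [X in measurable X](_ : _ = set0)//; apply/seteqP; split.
pose B := [set w | exists u k, steps_made (fun v n => S v n w) t u = Some k /\
                               S u k.+1 w = v].
have mB : measurable B.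
  apply: measurable_exists => u; apply: measurable_exists => k.
  by apply: measurable_and; [exact: IHt|exact: mS].
pose A := [set w | steps_made (fun v n => S v n w) t v = None].
have mA : measurable A by exact: IHt.
case: o => [[|k]|].
- rewrite [X in measurable X](_ : _ = A `&` B); first exact: measurableI.
  apply/seteqP; split=> w; rewrite /A /B /=.
    by case: (steps_made _ t v) => //=; case: asboolP.
  by case=> -> H; rewrite asboolT.
- rewrite [X in measurable X](_ : _ =
      [set w | steps_made (fun v n => S v n w) t v = Some k]); first exact: IHt.
  apply/seteqP; split=> w /=; last by move=> ->.
  by case: (steps_made _ t v) => [j [->]//|]; case: asboolP.
- rewrite [X in measurable X](_ : _ = A `\` B); first exact: measurableD.
  apply/seteqP; split=> w; rewrite /A /B /=.
    by case: (steps_made _ t v) => //=; case: asboolP.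
  by case=> -> H; rewrite asboolF.
Qed.

Lemma measurable_root_moves_ge M :
  measurable [set w | root_moves_ge (fun v n => S v n w) M].
Proof.
apply: measurable_exists => l.
have [/eqP sl|sl] := boolP (size l == M); last first.
  rewrite [X in measurable X](_ : _ = set0)//; apply/seteqP; split=> // w [].
  by move=> /eqP; rewrite (negbTE sl).
have [ul|ul] := boolP (uniq l); last first.
  by rewrite [X in measurable X](_ : _ = set0)//; apply/seteqP; split=> // w [].
rewrite [X in measurable X](_ : _ = \bigcap_(x in [set` l])
    [set w | root_moves (fun v n => S v n w) x]).
  apply: fin_bigcap_measurable => [|x _]; first exact: finite_seq.
  apply: measurable_exists => k.
  by apply: measurable_and; [exact: measurable_steps_made|exact: mS].
by apply/seteqP; split=> w /=; [case|split].
Qed.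

End Measurability.

(** * Conditional laws given the beginnings of the walks *)

Section Cylinders.
Context {R : realType} {disp : measure_display} {T : measurableType disp}.
Context {P : probability T R} {d : nat} {p : R}.
Context {S : vertex d -> nat -> T -> vertex d}.
Context (walks : frog_walks P p S).
Implicit Types (v w x y : vertex d) (pi : seq (vertex d)).
Implicit Types (e : vertex d * seq (vertex d)).
Implicit Types (c : seq (vertex d * seq (vertex d))).

(** The frog of v begins its walk by visiting the vertices of pi, latest
    first: with this order a further step is a cons. *)
Definition follows v pi : set T :=
  [set o | forall k, (k <= size pi)%N -> S v k o = nth v (v :: rev pi) k].

Definition cylinder c : set T :=
  [set o | forall e, e \in c -> follows e.1 e.2 o].

Let walk v : is_biased_walk P p v (S v).
Proof. by case: walks. Qed.

Lemma follows_nil v : follows v [::] = setT.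
Proof.
apply/seteqP; split=> o // _ k; rewrite leqn0 => /eqP ->.
by case: (walk v) => _ ->.
Qed.

Lemma follows_cons v y pi :
  follows v (y :: pi) = follows v pi `&` [set o | S v (size pi).+1 o = y].
Proof.
have E k : (k <= size pi)%N -> nth v (v :: rev (y :: pi)) k = nth v (v :: rev
  pi) k.
  by move=> kpi; rewrite rev_cons -rcons_cons nth_rcons /= size_rev ltnS kpi.
apply/seteqP; split=> o /=.
  move=> H; split=> [k kpi|]; first by rewrite H ?E// (leq_trans kpi).
  by rewrite H// rev_cons -rcons_cons nth_rcons /= size_rev ltnn eqxx.
move=> [H Hy] k; rewrite leq_eqVlt => /predU1P[->|].
  by rewrite Hy rev_cons -rcons_cons nth_rcons /= size_rev ltnn eqxx.
by rewrite ltnS => kpi; rewrite E// H.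
Qed.

Lemma probability_follows_cons v y pi :
  P (follows v (y :: pi)) =
  (P (follows v pi) * (step_prob p (head v pi) y)%:E)%E.
Proof.
case: (walk v) => _ _ /(_ (size pi) (nth v (v :: rev (y :: pi)))).
rewrite -/(follows v (y :: pi)) => ->.
have nthE k : nth v (v :: rev (y :: pi)) k =
    if (k <= size pi)%N then nth v (v :: rev pi) k
    else if k == (size pi).+1 then y else v.
  by rewrite rev_cons -rcons_cons nth_rcons /= size_rev ltnS.
rewrite !nthE leqnn ltnn eqxx.
have -> : nth v (v :: rev pi) (size pi) = head v pi.
  by case: pi {nthE} => // z pi; rewrite rev_cons -rcons_cons nth_rcons /=
    size_rev ltnn eqxx.
congr (_ * _)%E; congr (P _).
by apply/seteqP; split=> o /= H k kpi; rewrite H// nthE kpi.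
Qed.

Lemma measurable_follows v pi : measurable (follows v pi).
Proof.
elim: pi => [|y pi IHpi]; first by rewrite follows_nil.
by rewrite follows_cons; apply: measurableI => //; case: (walk v) => + _ _;
  exact.
Qed.

Lemma walk_sigma_algebra_follows v pi :
  walk_sigma_algebra (S v) (follows v pi).
Proof.
rewrite /walk_sigma_algebra; set G := [set A | _].
elim: pi => [|y pi IHpi].
  rewrite follows_nil.
  exact: (@measurableT _ (g_sigma_algebraType G)).
rewrite follows_cons.
apply: (@measurableI _ (g_sigma_algebraType G)) => //.
by apply: sub_sigma_algebra; exists (size pi).+1, y.
Qed.

Lemma cylinder_cons e c : cylinder (e :: c) = follows e.1 e.2 `&` cylinder c.
Proof.
apply/seteqP; split=> o /=.
  by move=> H; split=> [|e' e'c]; apply: H; rewrite inE ?eqxx ?e'c ?orbT.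
by move=> [He Hc] e' /predU1P[->//|]; exact: Hc.
Qed.

Lemma cylinder_perm c c' : perm_eq c c' -> cylinder c = cylinder c'.
Proof.
move=> cc'; apply/seteqP; split=> o H e; first by rewrite -(perm_mem cc');
  exact: H.
by rewrite (perm_mem cc'); exact: H.
Qed.

Lemma measurable_cylinder c : measurable (cylinder c).
Proof.
elim: c => [|e c IHc].
  by rewrite [X in measurable X](_ : _ = setT)//; apply/seteqP; split.
by rewrite cylinder_cons; apply: measurableI => //; exact: measurable_follows.
Qed.

(** Independence applies because fixing finitely many steps of a walk is an
    event of its sigma-algebra. *)
Lemma probability_cylinder c : uniq (unzip1 c) ->
  P (cylinder c) = (\prod_(e <- c) P (follows e.1 e.2))%E.
Proof.
move=> uc; case: walks => _ indep.
pose A v := follows v (nth [::] (unzip2 c) (index v (unzip1 c))).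
have AE e : e \in c -> A e.1 = follows e.1 e.2.
  move=> ec; rewrite /A; congr follows; have := ec; rewrite -index_mem => ic.
  have -> : index e.1 (unzip1 c) = index e c.
    rewrite -{1}(nth_index e ec) -(nth_map _ e.1) ?index_uniq ?size_map//.
  by rewrite (nth_map e) ?nth_index.
have sA v : v \in unzip1 c -> walk_sigma_algebra (S v) (A v).
  by move=> _; exact: walk_sigma_algebra_follows.
have := indep (unzip1 c) A uc sA.
rewrite big_map => {}indep.
transitivity (\prod_(e <- c) P (A e.1))%E; last first.
  by rewrite big_seq [RHS]big_seq; apply: eq_bigr => e ec; rewrite AE.
rewrite -indep.
suff -> : cylinder c = \bigcap_(v in [set` unzip1 c]) A v by [].
apply/seteqP; split=> o /=.
  by move=> H v /= /mapP[e ec ->]; rewrite AE//; exact: H.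
by move=> H e ec; rewrite -AE//; apply: H; exact: map_f.
Qed.

Lemma probability_cylinder_step v y pi c : uniq (v :: unzip1 c) ->
  P (cylinder ((v, y :: pi) :: c)) =
  (P (cylinder ((v, pi) :: c)) * (step_prob p (head v pi) y)%:E)%E.
Proof.
move=> uc; rewrite !probability_cylinder// !big_cons /=
  probability_follows_cons.
by rewrite muleAC.
Qed.

Lemma probability_split (A : set T) (X : T -> vertex d) (ys : seq (vertex d)) :
  measurable A -> (forall y, measurable [set o | X o = y]) -> uniq ys ->
  P A = (\sum_(y <- ys) P (A `&` [set o | X o = y])
         + P (A `&` [set o | X o \notin ys]))%E.
Proof.
move=> + mX; elim: ys A => [|y ys IHys] A mA /=.
  rewrite big_nil add0e => _.
  suff -> : A `&` [set o | X o \notin [::]] = A by [].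
  by apply/seteqP; split=> o //= [].
move=> /andP[yys uys]; rewrite big_cons.
rewrite (@measureDI _ _ _ P A [set o | X o = y])// [LHS]addeC -addeA.
congr (_ + _)%E; apply: (eq_trans (IHys _ (measurableD mA (mX y)) uys)).
congr (_ + _)%E.
  rewrite big_seq [RHS]big_seq; apply: eq_bigr => z zys.
  suff -> : (A `\` [set o | X o = y]) `&` [set o | X o = z] = A `&` [set o | X
    o = z] by [].
  apply/seteqP; split=> o /= [].
    by move=> [].
  by move=> Ao Xz; split=> //; split=> // Xy; move: yys; rewrite -Xy Xz zys.
suff -> : (A `\` [set o | X o = y]) `&` [set o | X o \notin ys] =
  A `&` [set o | X o \notin y :: ys] by [].
apply/seteqP; split=> o /=; rewrite inE negb_or.
  by move=> [[Ao /eqP ->] ->].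
by move=> [Ao /andP[/eqP]].
Qed.

Definition shadow c := [seq (e.1, head e.1 e.2) | e <- c].

(** The conditional probability given the cylinder, stated as a product to
    allow null cylinders.  Only the shadow of the revealed walks matters, namely
    the current positions, provided that all their frogs are awake. *)
Definition visits_bound M (s : seq (vertex d * vertex d)) (b : R) :=
  well_formed s -> forall c, perm_eq (shadow c) s ->
  (forall o, cylinder c o -> forall v, v \in unzip1 c ->
     awake (fun v n => S v n o) v) ->
  (P (cylinder c `\` [set o | root_moves_ge (fun v n => S v n o) M])
     <= b%:E * P (cylinder c))%E.

Lemma unzip1_shadow c : unzip1 (shadow c) = unzip1 c.
Proof. by rewrite /unzip1 -map_comp. Qed.

Lemma child_cons x y : is_child x y -> exists j, x = j :: y.
Proof. by case: x => // j x /eqP ->; exists j. Qed.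

Lemma well_formed_arrive w x y (s : seq (vertex d * vertex d)) :
  well_formed ((w, x) :: s) -> is_child x y || is_child y x ->
  well_formed (arrive w y s).
Proof.
move=> [us closed pos] xy; have xs : x \in w :: unzip1 s.
  exact: (pos (w, x) (mem_head _ _)).
have pos' q : q \in s -> q.2 \in w :: unzip1 s.
  by move=> qs; apply: pos; rewrite inE qs orbT.
rewrite /arrive; case: ifPn => ys.
  by split=> // e /predU1P[->|/pos'].
split=> [|i u|e].
- by rewrite /= ys.
- move=> /predU1P[Ey|/closed uws]; apply/predU1P; right=> //.
  case/orP: xy => /child_cons[j Ej].
    by move: ys; rewrite (closed j)// -Ej.
  by move: Ey; rewrite /= Ej => -[_ ->].
- by move=> /predU1P[->|/predU1P[->|/pos' es]]; rewrite /= inE ?eqxx// es orbT.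
Qed.

(** Whichever awake frog is chosen, its next step splits the cylinder into
    smaller ones whose conditional probabilities are given by step_prob.  The
    walks that leave the list ys have probability zero. *)
Lemma visits_bound_step M w x s (ys : seq (vertex d)) (b : vertex d -> R) :
  uniq ys -> \sum_(y <- ys) step_prob p x y = 1 ->
  (forall y, y \in ys -> is_child x y || is_child y x) ->
  (forall y, y \in ys -> visits_bound M (arrive w y s) (b y)) ->
  visits_bound M ((w, x) :: s) (\sum_(y <- ys) step_prob p x y * b y).
Proof.
move=> uys sum1 near bound wf c cs awk; set E := [set o | _].
have mE : measurable E.
  by apply: measurable_root_moves_ge => v n y; case: (walk v) => + _ _; exact.
have : (w, x) \in shadow c by rewrite (perm_mem cs) mem_head.
move=> /mapP[[w' pi] ec [Ew Ex]]; rewrite /= in Ew Ex; subst w' x.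
set c' := rem (w, pi) c.
have cc' : perm_eq c ((w, pi) :: c') by exact: perm_to_rem.
have c's : perm_eq (shadow c') s.
  rewrite -(perm_cons (w, head w pi)); apply: perm_trans cs.
  by rewrite perm_sym; apply: (perm_map (fun e => (e.1, head e.1 e.2)) cc').
have idc : perm_eq (unzip1 c') (unzip1 s).
  by rewrite -unzip1_shadow; apply: perm_map.
have uc' : uniq (w :: unzip1 c').
  rewrite (perm_uniq (s2 := w :: unzip1 s)) ?perm_cons//.
  by case: wf.
rewrite (cylinder_perm cc'); set C := cylinder _.
have mC : measurable C by exact: measurable_cylinder.
pose X := S w (size pi).+1.
have mX y : measurable [set o | X o = y] by case: (walk w) => + _ _; exact.
have CyE y : cylinder ((w, y :: pi) :: c') = C `&` [set o | X o = y].
  by rewrite /C !cylinder_cons follows_cons setIAC.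
have PCy y : P (C `&` [set o | X o = y]) = (P C * (step_prob p (head w pi)
  y)%:E)%E.
  by rewrite -CyE probability_cylinder_step.
have fin : P C \is a fin_num by exact: fin_num_measure.
set r := fine (P C); have PCr : P C = r%:E by rewrite /r fineK.
have mout (A : set T) : measurable A ->
    measurable (A `&` [set o | X o \notin ys]).
  move=> mA; rewrite [X in measurable X](_ : _ =
      A `\` \bigcup_(y in [set` ys]) [set o | X o = y]).
    apply: measurableD => //; apply: fin_bigcup_measurable => [|y _].
      exact: finite_seq.
    exact: mX.
  apply/seteqP; split=> o /= [Ao].
    by move=> /negP Xys; split=> // -[y yys Xy]; apply: Xys; rewrite Xy.
  by move=> Xys; split=> //; apply/negP => Xin; apply: Xys; exists (X o).
(* The pieces indexed by ys already carry the whole mass of C. *)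
have null : P (C `&` [set o | X o \notin ys]) = 0%E.
  have := probability_split mC mX uys.
  rewrite (eq_bigr (fun y => (r * step_prob p (head w pi) y)%:E)); last first.
    by move=> y _; rewrite PCy PCr EFinM.
  rewrite sumEFin -mulr_sumr sum1 mulr1 PCr.
  have /fineK <- : P (C `&` [set o | X o \notin ys]) \is a fin_num.
    by apply: fin_num_measure; exact: mout.
  by rewrite -EFinD => -[/eqP]; rewrite -subr_eq0 opprD addrA subrr sub0r
    oppr_eq0 => /eqP ->.
apply: (le_trans (y := (\sum_(y <- ys) P ((C `\` E) `&` [set o | X o = y]))%E)).
  rewrite (probability_split _ mX uys); last exact: measurableD.
  rewrite geeDl// -null; apply: le_measure.
  - by apply/mem_set/mout; exact: measurableD.
  - by apply/mem_set/mout.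
  - by move=> o [[? ?] ?].
apply: (le_trans (y := (\sum_(y <- ys) (b y * (r * step_prob p (head w pi)
  y))%:E)%E)).
  rewrite big_seq [leRHS]big_seq; apply: lee_sum => y yys.
  have -> : (C `\` E) `&` [set o | X o = y] = cylinder ((w, y :: pi) :: c') `\`
    E.
    by rewrite CyE; apply/seteqP; split=> o /= [[]].
  rewrite EFinM EFinM -PCr -PCy -CyE.
  have wfy := well_formed_arrive wf (near y yys).
  have awky o : cylinder ((w, y :: pi) :: c') o -> forall v,
      v \in [:: y, w & unzip1 c'] -> awake (fun v n => S v n o) v.
    rewrite CyE => -[Co Xo].
    have awk' v : v \in w :: unzip1 c' -> awake (fun v n => S v n o) v.
      move=> vc; apply: awk; first by rewrite (cylinder_perm cc').
      by rewrite (perm_mem (perm_map _ cc')).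
    move=> v /predU1P[->|]; last exact: awk'.
    by rewrite -Xo; apply: awake_visited; apply: awk'; rewrite mem_head.
  have idE : (y \in w :: unzip1 c') = (y \in w :: unzip1 s).
    by rewrite !inE (perm_mem idc).
  move: (bound y yys wfy); rewrite /arrive -idE; case: ifP => yc H.
    apply: H => [|o Co v vc]; first by rewrite /= perm_cons.
    by apply: (awky o Co); rewrite inE vc orbT.
  have Ey : cylinder ((y, [::]) :: (w, y :: pi) :: c') = cylinder ((w, y :: pi)
    :: c').
    by rewrite cylinder_cons follows_nil setTI.
  rewrite -Ey; apply: H => [|o]; first by rewrite /= !perm_cons.
  by rewrite Ey => Co v vc; exact: (awky o Co).
rewrite PCr sumEFin -EFinM lee_fin mulr_suml le_eqVlt; apply/orP; left;
  apply/eqP.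
by apply: eq_bigr => y _; ring.
Qed.

Lemma visits_bound_win M s : (M < at_root s)%N -> visits_bound M s 0.
Proof.
move=> Ms [us _ _] c cs awk.
suff -> : cylinder c `\` [set o | root_moves_ge (fun v n => S v n o) M] = set0.
  by rewrite measure0 mul0e.
apply/seteqP; split=> // o [Co]; case.
pose l := [seq e <- c | (head e.1 e.2 == tree_root d) && (e.2 != [::])].
have uc : uniq (unzip1 c).
  by rewrite -unzip1_shadow (perm_uniq (perm_map _ cs)).
apply: (@root_moves_ge_distinct _ _ M (unzip1 l)).
- rewrite size_map size_filter -ltnS; apply: (leq_trans Ms).
  rewrite /at_root -(permP cs) count_map.
  apply: (@leq_trans (count (fun e => (head e.1 e.2 == tree_root d) && (e.2 !=
    [::])) c
                      + count (fun e => e.1 == tree_root d) c)%N).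
    rewrite -count_predUI (leq_trans _ (leq_addr _ _))// sub_count// => -[v [|y
      pi]] /=.
      by move=> ->; rewrite orbT.
    by move=> ->.
  rewrite -addn1 leq_add2l.
  by rewrite -(count_map fst (pred1 (tree_root d))) count_uniq_mem//;
    case: (_ \in _).
- by apply: subseq_uniq uc; apply: map_subseq; exact: filter_subseq.
- move=> v /mapP[[v' [|y pi]]]; rewrite mem_filter /= ?andbF// andbT.
  move=> /andP[/eqP -> ec] ->; exists (size pi).
    by apply: awk => //; exact: (map_f fst ec).
  by have := Co _ ec; rewrite follows_cons => -[].
Qed.

Context (d_gt0 : (0 < d)%N).

Lemma failure_rules_visits M : failure_rules p M (visits_bound M).
Proof.
have d0 : d%:R != 0 :> R by rewrite pnatr_eq0 -lt0n.
have mE : measurable [set o | root_moves_ge (fun v n => S v n o) M].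
  by apply: measurable_root_moves_ge => v n y; case: (walk v) => + _ _; exact.
have children x : uniq [seq j :: x | j : 'I_d].
  by rewrite map_inj_uniq ?enum_uniq// => j k [].
have child_sum x (f : vertex d -> R) :
    \sum_(y <- [seq j :: x | j : 'I_d]) f y = \sum_j f (j :: x).
  by rewrite big_map big_enum.
split.
- move=> s s' b ss' bound [us closed pos] c cs; apply: bound.
  + have idE : unzip1 s =i unzip1 s' by apply/perm_mem; exact: perm_map.
    split=> [|i u|e]; first by rewrite (perm_uniq (perm_map fst ss')).
      by rewrite !idE; exact: closed.
    by rewrite (perm_mem ss') idE; exact: pos.
  + by rewrite perm_sym in ss'; exact: perm_trans cs ss'.
- move=> s b b' bb' bound wf c cs awk; apply: le_trans (bound wf c cs awk) _.
  by rewrite lee_wpmul2r// lee_fin.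
- by move=> s b bound wf; exact: bound.
- move=> s wf c cs awk; rewrite mul1e; apply: le_measure.
  + by apply/mem_set/measurableD => //; exact: measurable_cylinder.
  + by apply/mem_set; exact: measurable_cylinder.
  + by move=> o [].
- by move=> s; exact: visits_bound_win.
- move=> w i u s b0 b bound0 bound.
  pose B y := if y == u then b0 else if y is j :: _ then b j else 0.
  have child_neq j : ([:: j, i & u] == u) = false.
    by apply/eqP => /(congr1 size) /=; lia.
  have child_neq2 j : (u == [:: j, i & u]) = false by rewrite eq_sym.
  have uE : step_prob p (i :: u) u = p.
    rewrite /step_prob /= eqxx mulr1.
    suff -> : is_child u (i :: u) = false by rewrite mul0r mulr0 addr0.
    by case: (u) => //= k u'; apply/eqP => /(congr1 size) /=; lia.
  have jE j : step_prob p (i :: u) [:: j, i & u] = (1 - p) / d%:R.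
    by rewrite /step_prob /= eqxx child_neq2 mulr0 add0r mul1r.
  have -> : p * b0 + (1 - p) * ((\sum_j b j) / d%:R) =
      \sum_(y <- u :: [seq j :: (i :: u) | j : 'I_d]) step_prob p (i :: u) y *
        B y.
    rewrite big_cons child_sum uE {1}/B eqxx; congr (_ + _).
    rewrite [RHS](eq_bigr (fun j => (1 - p) / d%:R * b j)); last first.
      by move=> j _; rewrite jE /B child_neq.
    by rewrite -mulr_sumr mulrAC mulrA.
  apply: visits_bound_step.
  + rewrite /= children andbT; apply/negP => /mapP[j _] uj.
    by have := child_neq j; rewrite -uj eqxx.
  + rewrite big_cons child_sum uE.
    rewrite (eq_bigr (fun=> (1 - p) / d%:R)); last by move=> j _; exact: jE.
    by rewrite sumr_const card_ord -[_ *+ d]mulr_natr mulfVK// addrC subrK.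
  + move=> y /predU1P[->|/mapP[j _ ->]]; first by rewrite /= eqxx.
    by rewrite /= eqxx orbT.
  + move=> y /predU1P[->|/mapP[j _ ->]]; first by rewrite /B eqxx.
    by rewrite /B child_neq; exact: bound.
- move=> w s b bound.
  pose B y := if y is j :: _ then b j else 0 : R.
  have jE (j : 'I_d) : step_prob p [::] [:: j] = 1 / d%:R by [].
  have -> : (\sum_j b j) / d%:R =
      \sum_(y <- [seq j :: [::] | j : 'I_d]) step_prob p [::] y * B y.
    rewrite child_sum [RHS](eq_bigr (fun j => d%:R^-1 * b j)); last first.
      by move=> j _; rewrite jE mul1r.
    by rewrite -mulr_sumr mulrC.
  apply: visits_bound_step.
  + exact: children.
  + rewrite child_sum (eq_bigr (fun=> d%:R^-1)); last first.
      by move=> j _; rewrite jE mul1r.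
    by rewrite sumr_const card_ord -[LHS]mulr_natr mulVf.
  + by move=> y /mapP[j _ ->].
  + by move=> y /mapP[j _ ->]; exact: bound.
Qed.

End Cylinders.

(** * Recurrence *)

Lemma recurrent_of_returns_large (R : realType) (d m : nat) (p Y : R) :
  0 < p -> p < 3^-1 -> (0 < d)%N -> (m <= d)%N -> 0 <= Y < 1 ->
  (forall e : R, 0 < e -> exists n (x : R),
    [/\ 1 - e <= x, 0 < x < 1 & pgf (returns p d m n) x <= Y]) ->
  recurrent d p.
Proof.
move=> p0 p3 d_gt0 md Y01 large disp T P S walks.
have p01 : 0 <= p <= 1 by apply/andP; split; lra.
pose E M := [set o | root_moves_ge (fun v n => S v n o) M].
have mE M : measurable (E M).
  by apply: measurable_root_moves_ge => v n x; case: walks => /(_ v)[].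
have E0 M : P (~` E M) = 0%E.
  apply/eqP; rewrite eq_le measure_ge0 andbT; apply/lee_addgt0Pr => e e0.
  rewrite add0e.
  have rules := failure_rules_visits walks d_gt0 M.
  have := fail_arbitrarily_small rules d_gt0 p0 p3 md Y01 large e0
    (s := [:: (tree_root d, tree_root d)]) isT.
  have wf : well_formed [:: (tree_root d, tree_root d)].
    by split=> // q; rewrite inE => /eqP ->; rewrite mem_head.
  move=> /(_ wf [:: (tree_root d, [::])] (perm_refl _)).
  rewrite cylinder_cons (follows_nil walks) setTI.
  rewrite [cylinder [::]](_ : _ = setT); last by apply/seteqP; split.
  rewrite setTD probability_setT mule1; apply => o _ v.
  by rewrite inE => /eqP ->; exact: awake_root.
have -> : [set o | root_visits (fun v n => S v n o) R = +oo%E] = \bigcap_M E M.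
  apply/seteqP; split=> o /=; first by move=> /root_visits_infinite H M _;
    exact: H.
  by move=> H; apply/root_visits_infinite => M; exact: H.
rewrite -[X in P X]setCK probability_setC; last first.
  by apply: measurableC; exact: bigcapT_measurable.
rewrite setC_bigcap; suff -> : P (\bigcup_M ~` E M) = 0%E by rewrite sube0.
apply/negligibleP; first by apply: bigcupT_measurable => M; exact: measurableC.
by apply: negligible_bigcup => M; apply/negligibleP;
  [exact: measurableC|exact: E0].
Qed.

Theorem theorem3 (R : realType) :
  (limn_esup (fun d : nat => critical_drift R d) <= (1 / 6 : R)%:E)%E.
Proof.
have [m [d0 large]] := @returns_large R.
apply: (@le_trans _ _ (ereal_sup
  ((fun d => critical_drift R d) @` [set d | (d0 <= d)%N]))).
  by apply: ereal_inf_lbound; exists [set d | (d0 <= d)%N] => //; exists d0.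
apply: ge_ereal_sup => _ [d /= dd0 <-].
have [d_gt0 [md [Y Y01 bound]]] := large d dd0.
apply: ereal_inf_lbound; exists (1 / 6 : R) => //; split.
  by apply/andP; split; lra.
by rewrite div1r; apply: recurrent_of_returns_large bound => //; lra.
Qed.
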